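(* Let $(W,S)$ be a finite irreducible Coxeter system with $S=\{s_1,\dots,s_n\}$ and Coxeter matrix $(m_{i,j})_{i,j\in[n]}$. Let $1\leq i<j\leq n$, and let $u,v\in S^*$ be two words. Let $b_{i,j}:=s_is_js_i\cdots$ be the alternating word of length $m_{i,j}$ starting with $s_i$, let $b_{j,i}:=s_js_is_j\cdots$ be the alternating word of length $m_{i,j}$ starting with $s_j$, and set \[ \kappa:=\sum_{i<k\leq j}|u|_k,\qquad \mu:=\sum_{i\leq k<j}|v|_k . \] Then the $S$-sign function $\sigma$ satisfies \[ \sigma(u\,b_{i,j}\,v)=\begin{cases}(-1)^{\frac{m_{i,j}}{2}}\,\sigma(u\,b_{j,i}\,v), & \text{if } m_{i,j}\text{ is even},\\ (-1)^{\kappa+\mu}\,\sigma(u\,b_{j,i}\,v), & \text{if } m_{i,j}\text{ is odd}.\end{cases} \]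
   Context: $[n]=\{1,\dots,n\}$. $S^*$ is the free monoid of finite words in the alphabet $S=\{s_1,\dots,s_n\}$, ordered by $s_1<s_2<\dots<s_n$. For a word $w\in S^*$, $|w|_k$ denotes the number of occurrences of the letter $s_k$ in $w$. For $w=w_1\cdots w_m$, the inversion number $\operatorname{inv}(w)$ is the smallest number of swaps of two consecutive letters needed to sort $w$ into non-decreasing order; equivalently it is the number of pairs $a<b$ in $[m]$ with $w_b<w_a$. The $S$-sign of $w$ is $\sigma(w):=(-1)^{\operatorname{inv}(w)}$. *)

(* Defs.v *)
From HB Require Import structures.
From mathcomp Require Import all_boot all_order all_algebra all_fingroup.

Set Implicit Arguments.
Unset Strict Implicit.
Unset Printing Implicit Defensive.

Import GRing.Theory.

(* Ordinals count from 0: the index k in {1, ..., n} is the ordinal of value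
   k - 1.  As differences and comparisons of indices are unaffected, ranges such
   as i < k <= j read the same. *)

Definition coxeter_matrix (n : nat) (m : 'M[nat]_n) : Prop :=
  [/\ forall i, m i i = 1,
      forall i j, m i j = m j i
    & forall i j, i != j -> 2 <= m i j].

(* (W, S) is a Coxeter system with matrix m, where S is enumerated by s: the
   group W has the presentation < s_1, ..., s_n | (s_i s_j)^(m i j) = 1 >,
   rendered by its universal property among all (possibly infinite) groups.
   An infinite entry of m would be an infinite order of some s_i s_j, so a
   matrix of natural numbers loses nothing when W is finite. *)
Definition coxeter_system (W : finGroupType) (n : nat) (s : 'I_n -> W)
    (m : 'M[nat]_n) : Prop :=
  [/\ coxeter_matrix m,
      <<[set s i | i : 'I_n]>>%g = [set: W],
      forall i j, ((s i * s j) ^+ m i j)%g = 1%g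
    & forall (G : groupType) (f : 'I_n -> G),
        (forall i j, ((f i * f j) ^+ m i j)%g = 1%g) ->
        exists2 phi : W -> G,
          {morph phi : x y / (x * y)%g} & forall i, phi (s i) = f i].

Definition coxeter_graph (n : nat) (m : 'M[nat]_n) : rel 'I_n :=
  fun i j => (i != j) && (3 <= m i j).

(* Irreducibility: the Coxeter graph is nonempty and connected. *)
Definition coxeter_irreducible (n : nat) (m : 'M[nat]_n) : Prop :=
  0 < n /\ forall i j : 'I_n, connect (coxeter_graph m) i j.

(* A letter s_k is represented by its index k, a word in the free monoid on S
   by a sequence of indices, and |w|_k by count_mem k w. *)
Notation word n := (seq 'I_n).

Section Inversions.
Variable n : nat.
Implicit Types (x y : 'I_n) (w t : word n).

Definition nondecreasing_word w : bool :=
  sorted (fun x y : 'I_n => x <= y) w.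

(* All words obtained from w by one swap of two consecutive letters. *)
Fixpoint swaps w : seq (word n) :=
  if w is x :: t then
    (if t is y :: t' then [:: y :: x :: t'] else [::]) ++
      [seq x :: t' | t' <- swaps t]
  else [::].

Fixpoint sortable_in (k : nat) w : bool :=
  if k is k'.+1 then has (sortable_in k') (swaps w) else nondecreasing_word w.

Fixpoint ninv w : nat :=
  if w is x :: t then count (fun y : 'I_n => y < x) t + ninv t else 0.

Lemma swaps_count w w' (P : pred 'I_n) : w' \in swaps w -> count P w' = count P w.
Proof.
elim: w w' => [|x t IHt] w' //=; rewrite mem_cat => /orP[|/mapP[t' /IHt Ht ->]].
  by case: t {IHt} => [|y t] //=; rewrite inE => /eqP-> /=; rewrite addnCA.
by rewrite /= Ht.
Qed.

Lemma swaps_ninv w w' : w' \in swaps w -> ninv w <= (ninv w').+1.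
Proof.
elim: w w' => [|x t IHt] w' //=; rewrite mem_cat => /orP[|/mapP[t' Ht ->]].
  case: t {IHt} => [|y t] //=; rewrite inE => /eqP-> /=.
  set a := count _ t; set b := count _ t.
  rewrite -!addnA (addnCA b) -addSn leq_add2r.
  by case: (y < x).
by rewrite /= (swaps_count _ Ht) -addnS leq_add2l IHt.
Qed.

Lemma ninv_sorted w : nondecreasing_word w -> ninv w = 0.
Proof.
elim: w => //= x t IHt Hs; rewrite IHt; last exact: path_sorted Hs.
rewrite addn0.
apply/eqP; rewrite -leqn0 leqNgt -has_count; apply/hasPn => y yt /=.
rewrite -leqNgt; have tr : transitive (fun x y : 'I_n => x <= y).
  by move=> a b c; apply: leq_trans.
by move/(order_path_min tr)/allP: Hs => /(_ y yt).
Qed.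

Lemma ninv_desc w :
  ~~ nondecreasing_word w -> exists2 w', w' \in swaps w & ninv w = (ninv w').+1.
Proof.
elim: w => [|x [|y t] IHt] // Hns.
have [yx|xy] := ltnP y x.
  exists (y :: x :: t); first by rewrite /= inE eqxx.
  by rewrite /= yx ltnNge (ltnW yx) /= !add0n -addnA add1n addnCA.
have /IHt[w' Hw' Hinv] : ~~ nondecreasing_word (y :: t).
  by apply: contra Hns; rewrite /nondecreasing_word /= xy.
exists (x :: w').
  have -> : swaps (x :: y :: t) =
      [:: y :: x :: t] ++ [seq x :: t' | t' <- swaps (y :: t)] by [].
  by rewrite mem_cat (map_f (cons x) Hw') orbT.
have -> : ninv (x :: y :: t) = count (fun z : 'I_n => z < x) (y :: t) + ninv (y :: t).
  by [].
by rewrite Hinv -(swaps_count _ Hw') addnS.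
Qed.

Lemma sortable_ninv w : sortable_in (ninv w) w.
Proof.
move: {2}(ninv w) (erefl (ninv w)) => k; elim: k w => [|k IHk] w Hk.
  rewrite Hk /=; apply/negPn/negP => /ninv_desc[w' _].
  by rewrite Hk.
rewrite Hk /=; have /ninv_desc[w' Hw' Hinv] : ~~ nondecreasing_word w.
  by apply/negP => /ninv_sorted; rewrite Hk.
have Hk' : ninv w' = k by case: Hinv; rewrite Hk => -[].
by apply/hasP; exists w' => //; rewrite -Hk' IHk.
Qed.

Lemma sortable_ge w k : sortable_in k w -> ninv w <= k.
Proof.
elim: k w => [|k IHk] w /=; first by move/ninv_sorted->.
by case/hasP => w' /swaps_ninv Hw /IHk Hk; apply: leq_trans Hw _.
Qed.

Lemma sortable_ex w : exists k, sortable_in k w.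
Proof. by exists (ninv w); apply: sortable_ninv. Qed.

Definition inv w : nat := ex_minn (sortable_ex w).

Lemma inv_ninv w : inv w = ninv w.
Proof.
rewrite /inv; case: ex_minnP => k Hk Hmin.
by apply/eqP; rewrite eqn_leq sortable_ge // Hmin // sortable_ninv.
Qed.

Lemma inv_pairs w :
  inv w = #|[set ab : 'I_(size w) * 'I_(size w) |
              (ab.1 < ab.2) &&
              (tnth (in_tuple w) ab.2 < tnth (in_tuple w) ab.1)]|.
Proof.
rewrite inv_ninv cardsE -sum1_card big_mkcond /=.
rewrite (eq_bigr (fun ab : 'I_(size w) * 'I_(size w) =>
   nat_of_bool ((ab.1 < ab.2) &&
     (tnth (in_tuple w) ab.2 < tnth (in_tuple w) ab.1)))); last first.
  by move=> ab _; rewrite unfold_in; case: ifP.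
rewrite -(pair_bigA _ (fun a b : 'I_(size w) => nat_of_bool ((a < b) &&
     (tnth (in_tuple w) b < tnth (in_tuple w) a)))) /=.
elim: w => [|x t IHt]; first by rewrite big_ord0.
rewrite [LHS]/= IHt big_ord_recl; congr (_ + _).
  rewrite big_ord_recl /= add0n -sum1_count big_tnth big_mkcond /=.
  by apply: eq_bigr => b _; rewrite !(tnth_nth x) /=; case: ifP.
apply: eq_bigr => a _; rewrite big_ord_recl /= add0n.
by apply: eq_bigr => b _; rewrite !(tnth_nth x) /= /bump /= !add1n ltnS.
Qed.

Definition ssign w : int := ((-1) ^+ inv w)%R.

(* The alternating word x y x y ... of length l. *)
Definition alternating x y (l : nat) : word n :=
  mkseq (fun k => if odd k then y else x) l.

End Inversions.

(* Main.v *)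
Require Import Defs.
From mathcomp Require Import all_boot all_order all_algebra all_fingroup.
From mathcomp Require Import zify.

(** Inversions of a concatenation split into those inside each factor and those
    between two factors.  The latter depend only on the letter counts, and the
    two alternating words have the same counts when m is even, while b_ij has
    one more s_i and one less s_j when m is odd.  Inside, b_ji has m/2 more
    inversions than b_ij when m is even, and equally many when m is odd. *)

Definition cross_inv (n : nat) (s t : word n) : nat :=
  \sum_(x <- s) count (fun y : 'I_n => y < x) t.

(** Grouping by the right-hand letter lets the sum run over an alternating word that stands on the
    right, as [sum_alternating] requires. *)
Lemma cross_invE (n : nat) (s t : word n) :
  cross_inv n s t = \sum_(y <- t) count (fun x : 'I_n => y < x) s.
Proof.
rewrite /cross_inv; under eq_bigr do rewrite -sum1_count big_mkcond.
rewrite exchange_big; apply: eq_bigr => y _.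
by rewrite -sum1_count [RHS]big_mkcond.
Qed.

Lemma cross_inv_catr (n : nat) (s t1 t2 : word n) :
  cross_inv n s (t1 ++ t2) = cross_inv n s t1 + cross_inv n s t2.
Proof.
by rewrite /cross_inv -big_split; apply: eq_bigr => x _; rewrite count_cat.
Qed.

Lemma ninv_cat (n : nat) (s t : word n) :
  ninv (s ++ t) = ninv s + ninv t + cross_inv n s t.
Proof.
rewrite /cross_inv; elim: s => [|x s IHs] /=; first by rewrite big_nil addn0.
by rewrite big_cons count_cat IHs; lia.
Qed.

Lemma alternatingS (n : nat) (x y : 'I_n) (l : nat) :
  alternating x y l.+1 = x :: alternating y x l.
Proof.
rewrite /alternating /mkseq /= (iotaDl 1 0) -map_comp; congr (_ :: _).
by apply: eq_map => k /=; case: (odd k).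
Qed.

Lemma sum_alternating (n : nat) (x y : 'I_n) (l : nat) (F : 'I_n -> nat) :
  \sum_(z <- alternating x y l) F z = uphalf l * F x + l./2 * F y.
Proof.
elim: l x y => [|l IHl] x y; first by rewrite big_nil.
by rewrite alternatingS big_cons IHl /= uphalfE; lia.
Qed.

Lemma count_alternating (n : nat) (x y : 'I_n) (l : nat) (P : pred 'I_n) :
  count P (alternating x y l) = uphalf l * P x + l./2 * P y.
Proof.
by rewrite -(sum_alternating _ x y l P) -sum1_count big_mkcond.
Qed.

(** Induction on the length: a leading [y] is inverted with each of the [uphalf l] letters [x] after
    it, a leading [x] with nothing, and the two tails are the same pair of words with roles
    exchanged. *)
Lemma ninv_alternating (n : nat) (x y : 'I_n) (l : nat) : x < y ->
  ninv (alternating y x l)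
    = ninv (alternating x y l) + (if odd l then 0 else l./2).
Proof.
move=> xy; elim: l => [|l IHl] //.
rewrite !alternatingS /= !count_alternating IHl !ltnn xy ltnNge (ltnW xy).
by rewrite uphalf_half; case: (odd l) => /=; lia.
Qed.

(** Turns the sums defining [kappa] and [mu] in the theorem into single counts over a word. *)
Lemma sum_count_mem (T : finType) (P : pred T) (w : seq T) :
  \sum_(k | P k) count_mem k w = count P w.
Proof.
elim: w => [|x w IHw] /=; first by rewrite big1.
rewrite big_split IHw /=; congr (_ + _).
rewrite big_mkcond (bigD1 x) //= eqxx big1 ?addn0 => [|k kx].
  by case: (P x).
by rewrite eq_sym (negbTE kx); case: (P k).
Qed.

Lemma count_gt_split (n : nat) (i j : 'I_n) (w : word n) : i <= j ->
  count (fun k : 'I_n => i < k) w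
    = count (fun k : 'I_n => j < k) w + count (fun k : 'I_n => i < k <= j) w.
Proof.
by move=> ij; elim: w => //= x w ->; lia.
Qed.

Lemma count_lt_split (n : nat) (i j : 'I_n) (w : word n) : i <= j ->
  count (fun k : 'I_n => k < j) w
    = count (fun k : 'I_n => k < i) w + count (fun k : 'I_n => i <= k < j) w.
Proof.
by move=> ij; elim: w => //= x w ->; lia.
Qed.

(** For odd [l], trading one [i] for a [j] loses [kappa] inversions with [u] and gains [mu] with
    [v]. The loss is added on the left to avoid truncated subtraction. *)
Lemma ninv_braid (n : nat) (i j : 'I_n) (l : nat) (u v : word n) : i < j ->
  let kappa := count (fun k : 'I_n => i < k <= j) u in
  let mu := count (fun k : 'I_n => i <= k < j) v in
  ninv (u ++ alternating j i l ++ v) + odd l * kappa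
    = ninv (u ++ alternating i j l ++ v)
      + (if odd l then mu else l./2).
Proof.
move=> ij kappa mu.
rewrite !ninv_cat !cross_inv_catr !(cross_invE _ u (alternating _ _ _)).
rewrite [cross_inv _ (alternating i j l) v]/cross_inv
  [cross_inv _ (alternating j i l) v]/cross_inv !sum_alternating.
rewrite (ninv_alternating _ _ _ _ ij) (count_gt_split _ _ _ u (ltnW ij)).
rewrite (count_lt_split _ _ _ v (ltnW ij)) -/kappa -/mu uphalf_half.
by case: (odd l) => /=; lia.
Qed.

Theorem theorem1 (W : finGroupType) (n : nat) (s : 'I_n -> W) (m : 'M[nat]_n)
    (hW : coxeter_system s m) (hirr : coxeter_irreducible m)
    (i j : 'I_n) (hij : i < j) (u v : word n) :
  let b_ij := alternating i j (m i j) in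
  let b_ji := alternating j i (m i j) in
  let kappa := \sum_(k < n | i < k <= j) count_mem k u in
  let mu := \sum_(k < n | i <= k < j) count_mem k v in
  ssign (u ++ b_ij ++ v) =
    (if odd (m i j) then (-1) ^+ (kappa + mu) * ssign (u ++ b_ji ++ v)
     else (-1) ^+ (m i j)./2 * ssign (u ++ b_ji ++ v))%R.
Proof.
move=> b_ij b_ji kappa mu; rewrite /ssign !inv_ninv.
have := ninv_braid _ i j (m i j) u v hij.
rewrite /= -!sum_count_mem -/kappa -/mu -/b_ij -/b_ji.
(* Both signs are reduced to the parity of their exponents, so the side on which [kappa] stands in
   [ninv_braid] is immaterial. *)
rewrite -!GRing.exprD -GRing.signr_odd.
case: (odd (m i j)) => H; rewrite -[RHS]GRing.signr_odd; congr (_ ^+ _)%R; lia.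
Qed.
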